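(* Let $B\in\mathbb{C}^{m\times n}$, $\tilde W\in\mathbb{C}^{n\times m}$ and $\tilde k=\mathrm{ind}(B\tilde W)$. Let $X\in\mathbb{C}^{m\times n}$ be a minimal rank $W$-weighted weak Drazin inverse of $B$. Then $Y=B^{\dagger}B\tilde W X\tilde W$ is the unique matrix $Y\in\mathbb{C}^{n\times m}$ satisfying $$YBY=Y,\qquad BY=B\tilde W X\tilde W\qquad\text{and}\qquad Y(B\tilde W)^{\tilde k+1}=B^{\dagger}(B\tilde W)^{\tilde k+1}.$$
   Context: For a square complex matrix $T$, $\mathrm{ind}(T)$ is the smallest nonnegative integer $k$ with $\mathrm{rank}(T^k)=\mathrm{rank}(T^{k+1})$ (with $T^0=I$). $B^{\dagger}$ is the Moore-Penrose inverse. For $B\in\mathbb{C}^{m\times n}$, $\tilde W\in\mathbb{C}^{n\times m}$ and $\tilde k=\mathrm{ind}(B\tilde W)$, a matrix $X\in\mathbb{C}^{m\times n}$ is a minimal rank $W$-weighted weak Drazin inverse of $B$ (with respect to the weight $\tilde W$) if $X\tilde W(B\tilde W)^{\tilde k+1}=(B\tilde W)^{\tilde k}$ and $\mathrm{rank}(X)=\mathrm{rank}((B\tilde W)^{\tilde k})$. *)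

(* Defs.v *)
From mathcomp Require Import all_boot all_order all_algebra.

Set Implicit Arguments.
Unset Strict Implicit.
Unset Printing Implicit Defensive.

Import Order.TTheory GRing.Theory Num.Theory.
Local Open Scope ring_scope.
Local Open Scope sesquilinear_scope.

Section MatrixIndex.
Variables (F : fieldType) (m : nat).
Implicit Type T : 'M[F]_m.

Lemma exists_mxindex T : exists k, \rank (T ^+ k) == \rank (T ^+ k.+1).
Proof.
case: (boolP [exists k : 'I_m.+1, \rank (T ^+ k) == \rank (T ^+ k.+1)]).
  by case/existsP=> k Tk; exists k.
rewrite negb_exists => /forallP neqT.
have rank_drop k : (k <= m.+1)%N -> (\rank (T ^+ k) + k <= m)%N.
  elim: k => [|k IHk] ltkm; first by rewrite addn0 rank_leq_row.
  have := neqT (Ordinal ltkm); rewrite /= => neqk.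
  apply: leq_trans (IHk (ltnW ltkm)); rewrite addnS -addSn leq_add2r.
  by rewrite ltn_neqAle eq_sym neqk exprS mxrankM_maxr.
by have := rank_drop _ (leqnn m.+1); rewrite addnS ltnNge leq_addl.
Qed.

Definition mxindex T : nat := ex_minn (exists_mxindex T).

End MatrixIndex.

Section MoorePenrose.
Variable C : numClosedFieldType.

Definition is_mp_inverse m n (B : 'M[C]_(m, n)) (X : 'M[C]_(n, m)) : bool :=
  [&& B *m X *m B == B,
      X *m B *m X == X,
      (B *m X) ^t* == B *m X
    & (X *m B) ^t* == X *m B].

Lemma mulmx_trmxC_eq0 m n (A : 'M[C]_(m, n)) : A *m A ^t* = 0 -> A = 0.
Proof.
move=> A0; apply/row_matrixP=> i; rewrite row0; apply/eqP.
case: eqVneq => // /dotmx_is_dotmx; rewrite dotmxE.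
have := congr1 (fun M : 'M[C]_m => M i i) A0; rewrite !mxE => A0ii.
suff -> : \sum_k row i A 0 k * (row i A) ^t* k 0 = 0 by rewrite ltxx.
by rewrite -[RHS]A0ii; apply: eq_bigr => k _; rewrite !mxE.
Qed.

Lemma gram_unitmx m n (A : 'M[C]_(m, n)) :
  row_free A -> A *m A ^t* \in unitmx.
Proof.
move=> freeA; rewrite -row_free_unit; apply: inj_row_free => v vA0.
apply/eqP; rewrite -(mulmx_free_eq0 _ freeA); apply/eqP/mulmx_trmxC_eq0.
by rewrite trmx_mul map_mxM mulmxA -[X in X *m _]mulmxA vA0 mul0mx.
Qed.

Lemma trmxC_mul m n p (A : 'M[C]_(m, n)) (B : 'M[C]_(n, p)) :
  (A *m B) ^t* = B ^t* *m A ^t*.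
Proof. by rewrite trmx_mul map_mxM. Qed.

Lemma trmxC_inv n (A : 'M[C]_n) : (invmx A) ^t* = invmx (A ^t*).
Proof. by rewrite trmx_inv map_invmx. Qed.

Lemma full_rank_mp_inverse m n p (L : 'M[C]_(m, p)) (R : 'M[C]_(p, n)) :
  row_full L -> row_free R -> exists X, is_mp_inverse (L *m R) X.
Proof.
move=> fullL freeR.
have RRu : R *m R ^t* \in unitmx by apply: gram_unitmx.
have LLu : L ^t* *m L \in unitmx.
  have := @gram_unitmx _ _ (L ^t*); rewrite trmxCK; apply.
  by rewrite /row_free mxrank_map mxrank_tr.
pose P := invmx (R *m R ^t*); pose Q := invmx (L ^t* *m L).
have PC : P ^t* = P by rewrite trmxC_inv trmxC_mul trmxCK.
have QC : Q ^t* = Q by rewrite trmxC_inv trmxC_mul trmxCK.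
pose X := R ^t* *m P *m Q *m L ^t*.
have BX : L *m R *m X = L *m Q *m L ^t*.
  by rewrite /X !mulmxA -(mulmxA L R) -(mulmxA L _ P) mulmxV // mulmx1.
have XB : X *m (L *m R) = R ^t* *m P *m R.
  rewrite /X !mulmxA -(mulmxA _ (L ^t*) L) -(mulmxA _ Q).
  by rewrite mulVmx // mulmx1.
exists X; rewrite /is_mp_inverse BX XB; apply/and4P; split; apply/eqP.
- by rewrite !mulmxA -(mulmxA _ (L ^t*) L) -(mulmxA L Q) mulVmx // mulmx1.
- by rewrite /X !mulmxA -(mulmxA _ R) -(mulmxA (R ^t*) P) mulVmx // mulmx1.
- by rewrite !trmxC_mul trmxCK QC mulmxA.
- by rewrite !trmxC_mul trmxCK PC mulmxA.
Qed.

Lemma exists_mp_inverse m n (B : 'M[C]_(m, n)) : exists X, is_mp_inverse B X.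
Proof.
rewrite -(mulmx_base B); apply: full_rank_mp_inverse.
  exact: col_base_full.
exact: row_base_free.
Qed.

(* Not to be confused with the library's [pinvmx], which is only a partial
   inverse and need not satisfy the Penrose equations. *)
Definition mp_inverse m n (B : 'M[C]_(m, n)) : 'M[C]_(n, m) :=
  xchoose (exists_mp_inverse B).

Lemma mp_inverseP m n (B : 'M[C]_(m, n)) : is_mp_inverse B (mp_inverse B).
Proof. exact: xchooseP. Qed.

Lemma mp_inverse_unique m n (B : 'M[C]_(m, n)) (X Y : 'M[C]_(n, m)) :
  is_mp_inverse B X -> is_mp_inverse B Y -> X = Y.
Proof.
case/and4P=> /eqP BXB /eqP XBX /eqP BXC /eqP XBC.
case/and4P=> /eqP BYB /eqP YBY /eqP BYC /eqP YBC.
have BXY : B *m X = B *m Y.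
  by rewrite -BXC -{1}BYB -(mulmxA _ B X) trmxC_mul BXC BYC mulmxA BXB.
have XYB : X *m B = Y *m B.
  by rewrite -XBC -{1}BYB -mulmxA mulmxA trmxC_mul XBC YBC -mulmxA (mulmxA B) BXB.
by rewrite -XBX -mulmxA BXY mulmxA XYB.
Qed.

Definition min_rank_weighted_weak_drazin m n
    (B : 'M[C]_(m, n)) (W : 'M[C]_(n, m)) (X : 'M[C]_(m, n)) : Prop :=
  let k := mxindex (B *m W) in
  X *m W *m (B *m W) ^+ k.+1 = (B *m W) ^+ k /\
  \rank X = \rank ((B *m W) ^+ k).

End MoorePenrose.

(* Main.v *)
(** Write [T = B W].  The two defining conditions give [im X = im T^k], hence
    [X = T^k Z] and [X W T X = X W T^(k+1) Z = X].  The latter makes the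
    candidate satisfy the system.  Conversely a solution [Y] satisfies
    [Y = Y B Y = Y T X W = Y T^(k+1) Z W], which the third equation determines. *)
Require Import Defs.
From mathcomp Require Import all_boot all_order all_algebra reals complex.

Import GRing.Theory.

Local Open Scope ring_scope.

(** [exprS] with [*m] for the ring product, so that it combines with [mulmxA]. *)
Lemma exprmxS (R : pzRingType) (m k : nat) (T : 'M[R]_m) :
  T ^+ k.+1 = T *m T ^+ k.
Proof. exact: exprS. Qed.

(** The column space of [A *m C] lies in that of [A], and equal ranks force equality; transposing
    turns this into row spaces, which [submx] compares. *)
Lemma mxrank_mul_factor {F : fieldType} {m n p : nat}
    (A : 'M[F]_(m, n)) (C : 'M[F]_(n, p)) :
  \rank A = \rank (A *m C) -> exists Z, A = A *m C *m Z.
Proof.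
move=> rankA.
have sub : ((A *m C)^T <= A^T)%MS by rewrite trmx_mul submxMl.
have : (A^T <= (A *m C)^T)%MS.
  by rewrite -(geq_leqif (mxrank_leqif_sup sub)) !mxrank_tr rankA.
case/submxP=> Z AZ; exists Z^T.
by apply: trmx_inj; rewrite trmx_mul trmxK.
Qed.

Lemma min_rank_weighted_weak_drazin_factor {C : numClosedFieldType} {m n : nat}
    {B : 'M[C]_(m, n)} {W : 'M[C]_(n, m)} {X : 'M[C]_(m, n)} :
  min_rank_weighted_weak_drazin B W X ->
  exists Z, X = (B *m W) ^+ mxindex (B *m W) *m Z.
Proof.
case=> XWT rankX.
have [|Z XZ] := mxrank_mul_factor X
  (W *m (B *m W) ^+ (mxindex (B *m W)).+1).
  by rewrite mulmxA XWT.
by exists Z; rewrite {1}XZ mulmxA XWT.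
Qed.

Lemma min_rank_weighted_weak_drazin_outer {C : numClosedFieldType} {m n : nat}
    {B : 'M[C]_(m, n)} {W : 'M[C]_(n, m)} {X : 'M[C]_(m, n)} :
  min_rank_weighted_weak_drazin B W X -> X *m W *m (B *m W) *m X = X.
Proof.
move=> hX; have [Z XZ] := min_rank_weighted_weak_drazin_factor hX.
case: hX => XWT _.
by rewrite {2}XZ mulmxA -(mulmxA (X *m W)) -exprmxS XWT.
Qed.

Theorem theorem3p1 (R : realType) (m n : nat)
    (B : 'M[R[i]]_(m, n)) (W : 'M[R[i]]_(n, m)) (X : 'M[R[i]]_(m, n)) :
  min_rank_weighted_weak_drazin B W X ->
  let k := mxindex (B *m W) in
  unique
    (fun Y : 'M[R[i]]_(n, m) =>
       [/\ Y *m B *m Y = Y,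
           B *m Y = B *m W *m X *m W
         & Y *m (B *m W) ^+ k.+1 = mp_inverse B *m (B *m W) ^+ k.+1])
    (mp_inverse B *m B *m W *m X *m W).
Proof.
move=> hX k.
have [/eqP BDB _ _ _] := and4P (mp_inverseP B).
have XWTX := min_rank_weighted_weak_drazin_outer hX.
have [Z XZ] := min_rank_weighted_weak_drazin_factor hX.
case: hX; rewrite -/k in XZ * => XWT _.
have TX : B *m W *m X = (B *m W) ^+ k.+1 *m Z.
  by rewrite XZ mulmxA exprmxS.
have BY : B *m (mp_inverse B *m B *m W *m X *m W) = B *m W *m X *m W.
  by rewrite !mulmxA BDB.
split; first split=> //.
(* The product contains the block [X W T X], which collapses to [X]. *)
- rewrite -[LHS]mulmxA BY !mulmxA.
  by rewrite -(mulmxA (mp_inverse B) B W) -[in RHS]XWTX !mulmxA.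
- have -> : mp_inverse B *m B *m W *m X *m W =
            mp_inverse B *m (B *m W) *m (X *m W) by rewrite !mulmxA.
  by rewrite -[LHS]mulmxA XWT -mulmxA -exprmxS.
- move=> Y [YBY BYE YT].
  (* [TX] exposes [T^(k+1)], in front of which [YT] trades [Y] for [mp_inverse B]; [TX] is then
     undone. *)
  rewrite -[RHS]YBY -(mulmxA Y B) BYE TX !mulmxA YT.
  by rewrite -(mulmxA _ _ Z) -TX !mulmxA.
Qed.
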